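(* Let $p$ be a prime number and let $f \in \mathbb{Z}_p\{X\}$ be a restricted power series in one variable $X$ such that $f$ and its formal derivative $f'$ have no common zeros in $\mathbb{Z}_p$. For $D \in \mathbb{N}$ let $f_D$ denote the polynomial consisting of all terms of $f$ of degree $\le D$. Then there exists $N \in \mathbb{N}$ such that for all $D \ge N$ the truncation $f_D$ has the same Igusa zeta function as $f$, i.e. $Z_{f_D}(s) = Z_f(s)$ for all $s \in \mathbb{C}$ with $\Re(s) > 0$.
   Context: $\mathbb{Z}_p\{X\}$ (one variable) is the ring of formal power series $\sum_{i \ge 0} a_i X^i$ with $a_i \in \mathbb{Z}_p$ and $|a_i|_p \to 0$ as $i \to \infty$. Such a series converges at every $x \in \mathbb{Z}_p$, and its formal derivative $f'(X) = \sum_{i\ge 1} i a_i X^{i-1}$ again lies in $\mathbb{Z}_p\{X\}$. For $f = \sum_i a_i X^i$, the truncation is $f_D(X) = \sum_{i \le D} a_i X^i$. For $g \in \mathbb{Z}_p\{X\}$ and $s \in \mathbb{C}$ with $\Re(s) > 0$, the Igusa zeta function is $Z_g(s) = \int_{\mathbb{Z}_p} |g(x)|_p^s\, |dx|$, where $|dx|$ is the Haar measure on $\mathbb{Q}_p$ normalized so that $\mathbb{Z}_p$ has measure $1$, $|\cdot|_p$ is the $p$-adic absolute value with $|p|_p = p^{-1}$, and $|0|_p^s = 0$. *)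

(* Defs.v *)
From HB Require Import structures.
From mathcomp Require Import all_boot all_order all_algebra.
From mathcomp Require Import complex.
From mathcomp Require Import all_classical all_reals all_analysis.

Set Implicit Arguments.
Unset Strict Implicit.
Unset Printing Implicit Defensive.

Import Order.TTheory GRing.Theory Num.Theory.
Import numFieldNormedType.Exports.

Local Open Scope classical_set_scope.
Local Open Scope ring_scope.

(* Z_p as the inverse limit of the rings Z/p^n Z: an element is a compatible
   sequence of canonical residues x_n in [0, p^n), for n >= 0. *)
Record padic_int (p : nat) := PadicInt {
  padic_res :> nat -> int ;
  padic_resP : forall n, padic_res n = (padic_res n.+1 %% (p ^ n)%N)%Z }.

Section PadicRing.
Variable p : nat.
Implicit Types (x y z : padic_int p) (u : nat -> int).

Lemma padic_ext x y : (forall n, x n = y n) -> x = y.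
Proof.
case: x y => [x hx] [y hy] /= /funext exy; subst y.
by congr PadicInt; exact: Prop_irrelevance.
Qed.

Lemma modz_expS (a : int) n :
  ((a %% (p ^ n.+1)%N)%Z = a %[mod (p ^ n)%N])%Z.
Proof.
have {2}-> : a = (a %/ (p ^ n.+1)%N)%Z * (p ^ n.+1)%N + (a %% (p ^ n.+1)%N)%Z.
  exact: divz_eq.
by rewrite expnS PoszM mulrA modzMDl.
Qed.

Lemma padic_mod x n : (x n %% (p ^ n)%N)%Z = x n.
Proof. by rewrite padic_resP modz_mod. Qed.

Lemma padic_compat x n : (x n.+1 = x n %[mod (p ^ n)%N])%Z.
Proof. by rewrite padic_mod -padic_resP. Qed.

Lemma padic_of_subproof u (hu : forall n, (u n.+1 = u n %[mod (p ^ n)%N])%Z) n :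
  (u n %% (p ^ n)%N)%Z = ((u n.+1 %% (p ^ n.+1)%N)%Z %% (p ^ n)%N)%Z.
Proof. by rewrite modz_expS hu. Qed.

Definition padic_of u hu : padic_int p :=
  PadicInt (@padic_of_subproof u hu).

Lemma padic_constP (a : int) (n : nat) : (a = a %[mod (p ^ n)%N])%Z.
Proof. by []. Qed.

Lemma padic_oppP x n : (- x n.+1 = - x n %[mod (p ^ n)%N])%Z.
Proof. by rewrite -modzNm padic_compat modzNm. Qed.

Lemma padic_addP x y n : (x n.+1 + y n.+1 = x n + y n %[mod (p ^ n)%N])%Z.
Proof. by rewrite -modzDm !padic_compat modzDm. Qed.

Lemma padic_mulP x y n : (x n.+1 * y n.+1 = x n * y n %[mod (p ^ n)%N])%Z.
Proof. by rewrite -modzMm !padic_compat modzMm. Qed.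

Definition padic_const (a : int) := padic_of (padic_constP a).
Definition padic_opp x := padic_of (padic_oppP x).
Definition padic_add x y := padic_of (padic_addP x y).
Definition padic_mul x y := padic_of (padic_mulP x y).

HB.instance Definition _ := gen_eqMixin (padic_int p).
HB.instance Definition _ := gen_choiceMixin (padic_int p).

Fact padic_addA : associative padic_add.
Proof. by move=> x y z; apply: padic_ext => n /=; rewrite modzDmr modzDml addrA. Qed.

Fact padic_addC : commutative padic_add.
Proof. by move=> x y; apply: padic_ext => n /=; rewrite addrC. Qed.

Fact padic_add0 : left_id (padic_const 0) padic_add.
Proof. by move=> x; apply: padic_ext => n /=; rewrite mod0z add0r padic_mod. Qed.

Fact padic_addN : left_inverse (padic_const 0) padic_opp padic_add.
Proof. by move=> x; apply: padic_ext => n /=; rewrite modzDml addNr. Qed.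

HB.instance Definition _ := GRing.isZmodule.Build (padic_int p)
  padic_addA padic_addC padic_add0 padic_addN.

Fact padic_mulA : associative padic_mul.
Proof. by move=> x y z; apply: padic_ext => n /=; rewrite modzMmr modzMml mulrA. Qed.

Fact padic_mulC : commutative padic_mul.
Proof. by move=> x y; apply: padic_ext => n /=; rewrite mulrC. Qed.

Fact padic_mul1 : left_id (padic_const 1) padic_mul.
Proof. by move=> x; apply: padic_ext => n /=; rewrite modzMml mul1r padic_mod. Qed.

Fact padic_mulDl : left_distributive padic_mul padic_add.
Proof. by move=> x y z; apply: padic_ext => n /=; rewrite modzMml modzDm mulrDl. Qed.

HB.instance Definition _ := GRing.Zmodule_isComPzRing.Build (padic_int p)
  padic_mulA padic_mulC padic_mul1 padic_mulDl.

HB.instance Definition _ := isPointed.Build (padic_int p) 0.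

(* The p-adic topology: the cosets x + p^n Z_p, i.e. the sets of all y with
   y n = x n, form a basis of open sets. *)
Definition padic_open : set_system (padic_int p) :=
  [set U | forall x, U x -> exists n : nat, forall y, y n = x n -> U y].

Fact padic_openT : padic_open setT.
Proof. by move=> x _; exists 0%N. Qed.

Lemma padic_res_le x y m n : (m <= n)%N -> x n = y n -> x m = y m.
Proof.
elim: n => [|n IH]; first by rewrite leqn0 => /eqP->.
rewrite leq_eqVlt => /orP[/eqP-> //|]; rewrite ltnS => le_mn exy.
by apply: IH => //; rewrite padic_resP exy -padic_resP.
Qed.

Fact padic_openI : setI_closed padic_open.
Proof.
move=> U V oU oV x [/oU[m hm] /oV[n hn]]; exists (maxn m n) => y yx; split.
  by apply: hm; apply: padic_res_le yx; exact: leq_maxl.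
by apply: hn; apply: padic_res_le yx; exact: leq_maxr.
Qed.

Fact padic_open_bigU (I : Type) (f : I -> set (padic_int p)) :
  (forall i, padic_open (f i)) -> padic_open (\bigcup_i f i).
Proof.
by move=> of_ x [i _ /of_[n hn]]; exists n => y /hn; exists i.
Qed.

HB.instance Definition _ := isOpenTopological.Build (padic_int p)
  padic_openT padic_openI padic_open_bigU.

End PadicRing.

(* The valuation: p^n divides x in Z_p if and only if x n = 0. *)
Definition padic_val (p : nat) (x : padic_int p) : nat :=
  xget 0%N [set n | x n = 0 /\ x n.+1 <> 0].

Definition padic_abs (R : realType) (p : nat) (x : padic_int p) : R :=
  if x == 0 then 0 else p%:R ^- padic_val x.

(* A power series over Z_p is given by its sequence of coefficients. *)
Definition restricted (R : realType) (p : nat) (f : nat -> padic_int p) : Prop :=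
  (fun i => padic_abs R (f i)) @ \oo --> (0 : R).

Definition ps_eval (p : nat) (f : nat -> padic_int p) (x : padic_int p) :
    padic_int p :=
  lim ((fun n => \sum_(i < n) f i * x ^+ i) @ \oo).

Definition ps_deriv (p : nat) (f : nat -> padic_int p) : nat -> padic_int p :=
  fun i => f i.+1 *+ i.+1.

Definition ps_trunc (p : nat) (D : nat) (f : nat -> padic_int p) :
    nat -> padic_int p :=
  fun i => if (i <= D)%N then f i else 0.

Definition padic_borel (p : nat) := g_sigma_algebraType (@open (padic_int p)).

(* The Haar measure of Q_p giving Z_p mass 1 only enters through its
   restriction to the Borel sets of the open subgroup Z_p. *)
Definition normalized_haar (R : realType) (p : nat)
    (mu : {measure set (padic_borel p) -> \bar R}) : Prop :=
  mu setT = 1%E /\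
  forall (a : padic_int p) (A : set (padic_int p)),
    measurable (A : set (padic_borel p)) ->
    mu [set a + x | x in A] = mu A.

(* t ^ s for a real t >= 0 and a complex exponent s, with 0 ^ s = 0. *)
Definition cpow (R : realType) (t : R) (s : R[i]) : R[i] :=
  if t == 0 then 0 else
  let r := t `^ complex.Re s in
  let theta := complex.Im s * ln t in
  Complex (r * cos theta) (r * sin theta).

Definition Cintegral (R : realType) d (T : measurableType d)
    (mu : {measure set T -> \bar R}) (h : T -> R[i]) : R[i] :=
  Complex (\int[mu]_x complex.Re (h x)) (\int[mu]_x complex.Im (h x)).

Definition igusa_zeta (R : realType) (p : nat)
    (mu : {measure set (padic_borel p) -> \bar R})
    (g : nat -> padic_int p) (s : R[i]) : R[i] :=
  Cintegral mu (fun x : padic_borel p => cpow (padic_abs R (ps_eval g x)) s).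

(* Main.v *)
Require Import Defs.
From HB Require Import structures.
From mathcomp Require Import all_boot all_order all_algebra.
From mathcomp Require Import complex zify ring.
From mathcomp Require Import all_classical all_reals all_analysis.

Set Implicit Arguments.
Unset Strict Implicit.
Unset Printing Implicit Defensive.

Import Order.TTheory GRing.Theory Num.Theory.
Import numFieldNormedType.Exports.

Local Open Scope classical_set_scope.
Local Open Scope ring_scope.

(** Write A_n(g) for the set of x in Z_p with g(x) = 0 modulo p^n. The function
    |g|^s is constant on each A_n(g) \ A_(n+1)(g) and takes there a value that
    depends on n only, so Z_g(s) is determined by the measures of the A_n(g)
    ([igusa_zeta_eq]). It is enough to find a precision K such that two series
    with the same coefficients modulo p^K have mu A_n equal for all n; a
    truncation f_D with D large has the coefficients of f modulo p^K.

    Since f and f' have no common zero, compactness of Z_p ([padic_konig])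
    yields m such that f and f' never vanish simultaneously modulo p^m
    ([uniform_nondegeneracy]). Take K = 2m. For n <= K the set A_n(g) only
    depends on g modulo p^K. For n >= K the measures are governed by Hensel's
    lemma: on the part of A_n(g) where g' has valuation exactly e < m, Taylor's
    formula

      g(x + p^(n-e) t) = g(x) + p^(n-e) t g'(x)   modulo p^(n+1)

    has a unique solution t modulo p to the left-hand side being 0
    ([zero_stratum_lift]). Hence this part of A_n(g) is a disjoint union of p
    translates of the corresponding part of A_(n+1)(g), and invariance of mu
    gives mu A_(n+1)(g) = p^-1 mu A_n(g) ([haar_zeros_modS]). The non-vanishing
    condition modulo p^m also only depends on g modulo p^K, so the same
    recursion holds for f and f_D, from the same initial value. *)

(** * Residues of p-adic integers *)

Section Residues.
Variable p : nat.
Implicit Types (x y h : padic_int p) (f g : nat -> padic_int p).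

Lemma padic_resD x y n : (x + y) n = ((x n + y n) %% (p ^ n)%N)%Z.
Proof. by []. Qed.

Lemma padic_resM x y n : (x * y) n = ((x n * y n) %% (p ^ n)%N)%Z.
Proof. by []. Qed.

Lemma padic_resN x n : (- x) n = ((- x n) %% (p ^ n)%N)%Z.
Proof. by []. Qed.

Lemma padic_res0 n : (0 : padic_int p) n = 0.
Proof. exact: mod0z. Qed.

Lemma padic_res_level0 x : x 0%N = 0.
Proof. by rewrite padic_resP expn0 modz1. Qed.

Lemma padic_res_nat k n : (k%:R : padic_int p) n = (k%:Z %% (p ^ n)%N)%Z.
Proof.
elim: k => [|k IH]; first by rewrite padic_res0 mod0z.
by rewrite -natr1 padic_resD IH modzDm -addn1 PoszD.
Qed.

Lemma padic_res_modz x m n : (m <= n)%N -> x m = (x n %% (p ^ m)%N)%Z.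
Proof.
elim: n => [|n IH]; first by rewrite leqn0 => /eqP->; rewrite padic_mod.
rewrite leq_eqVlt => /orP[/eqP->|]; first by rewrite padic_mod.
rewrite ltnS => le_mn; rewrite IH//; apply/eqP; rewrite eqz_mod_dvd.
apply: (@dvdz_trans (p ^ n)%N); first exact: dvdn_exp2l.
by rewrite -eqz_mod_dvd padic_mod -padic_resP.
Qed.

Lemma padic_res_dvdz x m n :
  (m <= n)%N -> ((p ^ m)%N %| x n)%Z = (x m == 0).
Proof.
by move=> le_mn; rewrite (padic_res_modz _ le_mn); apply/dvdz_mod0P/eqP.
Qed.

Lemma padic_congrD x x' y y' n :
  x n = x' n -> y n = y' n -> (x + y) n = (x' + y') n.
Proof. by rewrite !padic_resD => -> ->. Qed.

Lemma padic_congrM x x' y y' n :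
  x n = x' n -> y n = y' n -> (x * y) n = (x' * y') n.
Proof. by rewrite !padic_resM => -> ->. Qed.

Lemma padic_congrX x y n i : x n = y n -> (x ^+ i) n = (y ^+ i) n.
Proof.
by move=> exy; elim: i => // i IH; rewrite !exprS; exact: padic_congrM.
Qed.

Lemma padic_congr_sum (F G : nat -> padic_int p) n M :
  (forall i, (i < M)%N -> F i n = G i n) ->
  (\sum_(i < M) F i) n = (\sum_(i < M) G i) n.
Proof.
elim: M => [|M IH] eFG; first by rewrite !big_ord0.
rewrite !big_ord_recr; apply: padic_congrD; last exact: eFG.
by apply: IH => i iM; apply: eFG; exact: ltnW.
Qed.

Lemma padic_congr_mulrn x y n k : x n = y n -> (x *+ k) n = (y *+ k) n.
Proof.
by move=> exy; elim: k => // k IH; rewrite !mulrS; exact: padic_congrD.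
Qed.

Lemma padic_mulrn_res0 x n k : x n = 0 -> (x *+ k) n = 0.
Proof.
rewrite -{1}(padic_res0 n) => /(padic_congr_mulrn k)->.
by rewrite mul0rn padic_res0.
Qed.

Lemma padic_digit_res0 k t : ((p ^ k * t)%:R : padic_int p) k = 0.
Proof. by rewrite padic_res_nat; apply/dvdz_mod0P; rewrite PoszM dvdz_mulr. Qed.

Lemma padic_mulr_res0 x y n : x n = 0 -> (x * y) n = 0.
Proof. by rewrite padic_resM => ->; rewrite mul0r mod0z. Qed.

Lemma padic_addr_res0 x y n : y n = 0 -> (x + y) n = x n.
Proof. by rewrite padic_resD => ->; rewrite addr0 padic_mod. Qed.

(** Bounds the quadratic remainder in Taylor's formula. *)
Lemma padic_sqr_res0 h k n : h k = 0 -> (n <= k.*2)%N -> (h ^+ 2) n = 0.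
Proof.
move=> hk nk; apply/eqP.
have [le_nk|/ltnW le_kn] := leqP n k.
  by rewrite expr2 padic_mulr_res0// (padic_res_modz _ le_nk) hk mod0z.
rewrite expr2 padic_resM; apply/eqP/dvdz_mod0P.
apply: (@dvdz_trans (p ^ k * p ^ k)%N).
  by rewrite -expnD addnn; exact: dvdn_exp2l.
by rewrite PoszM; apply: dvdz_mul; rewrite padic_res_dvdz// hk.
Qed.

Lemma padic_hausdorff : hausdorff_space (padic_int p).
Proof.
move=> x y clxy; apply: padic_ext => n.
have nbh (z : padic_int p) : nbhs z [set w | w n = z n].
  apply: open_nbhs_nbhs; split=> //.
  by move=> w /= wz; exists n => v vw; rewrite /= vw.
by have [z [/= <- <-]] := clxy _ _ (nbh x) (nbh y).
Qed.

Lemma padic_nbhs x (U : set (padic_int p)) :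
  nbhs x U -> exists n, forall y, y n = x n -> U y.
Proof.
rewrite nbhsE => -[V [oV Vx] VU].
by have [n hn] := oV x Vx; exists n => y /hn/VU.
Qed.

(** * Evaluation of restricted power series *)

(** Convergence of the coefficients to 0, stated through residues so that the
    field R of values of the absolute value does not enter. *)
Definition coef_to0 f := forall n, exists M, forall i, (M <= i)%N -> f i n = 0.

Lemma padic_partial_sum_res f x n M M' :
  (forall i, (M <= i)%N -> f i n = 0) -> (M <= M')%N ->
  (\sum_(i < M') f i * x ^+ i) n = (\sum_(i < M) f i * x ^+ i) n.
Proof.
move=> fM; elim: M' => [|M' IH]; first by rewrite leqn0 => /eqP->.
rewrite leq_eqVlt => /orP[/eqP->//|]; rewrite ltnS => leM.
by rewrite big_ord_recr padic_addr_res0 ?IH//; apply/padic_mulr_res0/fM.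
Qed.

(** Partial sums stabilise modulo every power of p, so the limit exists and
    each of its residues is a finite computation. *)
Lemma ps_eval_res f x n M : coef_to0 f ->
  (forall i, (M <= i)%N -> f i n = 0) ->
  ps_eval f x n = (\sum_(i < M) f i * x ^+ i) n.
Proof.
move=> f0 fM; pose B k := projT1 (cid (f0 k)).
have BP k i : (B k <= i)%N -> f i k = 0 by exact: (projT2 (cid (f0 k))).
pose S N := \sum_(i < N) f i * x ^+ i.
have SE k N : (B k <= N)%N -> S N k = S (B k) k.
  by move=> ?; apply: padic_partial_sum_res => //; exact: BP.
have compat k : (S (B k.+1) k.+1 = S (B k) k %[mod (p ^ k)%N])%Z.
  rewrite padic_mod -(SE k (maxn (B k) (B k.+1))) ?leq_maxl//.
  by rewrite -(SE k.+1 (maxn (B k) (B k.+1))) ?leq_maxr// -padic_resP.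
pose l := padic_of compat.
have lE k : l k = S (B k) k by rewrite /l /= padic_mod.
have -> : ps_eval f x = l.
  apply: cvg_lim; first exact: padic_hausdorff.
  move=> U /padic_nbhs[k hk]; exists (B k) => // N /= BN.
  by apply: hk; rewrite lE -(SE k N).
rewrite lE; have [le|/ltnW le] := leqP M (B n).
  exact: padic_partial_sum_res.
by rewrite /S -(@padic_partial_sum_res f x n (B n) M)//; exact: BP.
Qed.

Lemma ps_eval_congr f g x y n : coef_to0 f -> coef_to0 g ->
  (forall i, f i n = g i n) -> x n = y n -> ps_eval f x n = ps_eval g y n.
Proof.
move=> f0 g0 efg exy; have [M fM] := f0 n.
rewrite (ps_eval_res _ f0 fM) (@ps_eval_res _ _ _ M g0); last first.
  by move=> i Mi; rewrite -efg fM.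
apply: (@padic_congr_sum (fun i => f i * x ^+ i) (fun i => g i * y ^+ i)).
move=> i _; apply: padic_congrM; first exact: efg.
exact: padic_congrX.
Qed.

Lemma coef_to0_deriv f : coef_to0 f -> coef_to0 (ps_deriv f).
Proof.
move=> f0 n; have [M fM] := f0 n; exists M => i Mi.
by apply: padic_mulrn_res0; rewrite fM// leqW.
Qed.

Lemma coef_to0_trunc f D : coef_to0 (ps_trunc D f).
Proof.
move=> n; exists D.+1 => i Di.
by rewrite /ps_trunc leqNgt Di padic_res0.
Qed.

End Residues.

Lemma taylor_exp2 (A : comPzRingType) (x h : A) i :
  exists c, (x + h) ^+ i.+1 = x ^+ i.+1 + h * (x ^+ i *+ i.+1) + h ^+ 2 * c.
Proof.
elim: i => [|i [c ec]]; first by exists 0; rewrite !expr1 expr0; ring.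
exists ((x ^+ i *+ i.+1) + c * (x + h)).
by rewrite exprSr ec !exprS; ring.
Qed.

(** The factor of [h] is a partial sum of the derivative with one term less,
    which is harmless once the coefficients vanish modulo the precision. *)
Lemma taylor_sum2 (A : comPzRingType) (f : nat -> A) (x h : A) M :
  exists c, \sum_(i < M.+1) f i * (x + h) ^+ i =
    \sum_(i < M.+1) f i * x ^+ i
    + h * (\sum_(i < M) (f i.+1 *+ i.+1) * x ^+ i) + h ^+ 2 * c.
Proof.
elim: M => [|M [c ec]].
  by exists 0; rewrite !big_ord_recr !big_ord0 /= !expr0; ring.
have [d ed] := taylor_exp2 x h M.
exists (c + f M.+1 * d).
rewrite big_ord_recr /= ec ed [\sum_(i < M.+2) _]big_ord_recr /=.
rewrite [\sum_(i < M.+1) (f i.+1 *+ i.+1) * x ^+ i]big_ord_recr /=.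
by ring.
Qed.

Section Newton.
Variable p : nat.
Implicit Types (x y h : padic_int p) (f g : nat -> padic_int p).

Lemma ps_eval_newton f x h k n : coef_to0 f -> h k = 0 -> (n <= k.*2)%N ->
  ps_eval f (x + h) n =
  ((ps_eval f x n + h n * ps_eval (ps_deriv f) x n) %% (p ^ n)%N)%Z.
Proof.
move=> f0 hk nk; have [M fM] := f0 n.
have f0' := coef_to0_deriv f0.
have fM' i : (M <= i)%N -> ps_deriv f i n = 0.
  by move=> Mi; apply: padic_mulrn_res0; rewrite fM// leqW.
have fMS i : (M.+1 <= i)%N -> f i n = 0 by move=> /ltnW/fM.
rewrite !(ps_eval_res _ f0 fMS) (ps_eval_res _ f0' fM').
have [c ->] := taylor_sum2 f x h M.
rewrite padic_addr_res0; last exact/padic_mulr_res0/(padic_sqr_res0 hk nk).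
by rewrite padic_resD padic_resM modzDmr.
Qed.

Lemma padic_valP x : x != 0 -> x (padic_val x) = 0 /\ x (padic_val x).+1 <> 0.
Proof.
move=> x0; rewrite /padic_val; case: xgetP => [v _ //|none]; exfalso.
move/eqP: x0; apply; apply: padic_ext => k; rewrite padic_res0.
elim: k => [|k IH]; first exact: padic_res_level0.
by apply: contrapT => nk; exact: (none k).
Qed.

Lemma leq_padic_val x n : x != 0 -> (n <= padic_val x)%N = (x n == 0).
Proof.
move=> /padic_valP[v0 v1]; have [le|lt] := leqP n (padic_val x).
  by rewrite (padic_res_modz _ le) v0 mod0z eqxx.
by apply/esym/eqP => xn; apply: v1; rewrite (padic_res_modz _ lt) xn mod0z.
Qed.

Lemma restricted_coef_to0 (R : realType) f :
  prime p -> restricted R f -> coef_to0 f.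
Proof.
move=> hp fc n.
have p1 : 1 < p%:R :> R by rewrite ltr1n prime_gt1.
have p0 : 0 < p%:R :> R by rewrite ltr0n prime_gt0.
have e0 : 0 < p%:R ^- n :> R by rewrite invr_gt0 exprn_gt0.
have [M _ HM] := cvgr0_norm_lt _ fc _ e0.
exists M => i /HM /=; rewrite /padic_abs.
have [->|fi0] := eqVneq (f i) 0; first by rewrite padic_res0.
rewrite ger0_norm ?invr_ge0 ?exprn_ge0 ?ltW// ltf_pV2 ?posrE ?exprn_gt0//.
rewrite ltr_eXn2l// => /ltnW le_n.
by apply/eqP; rewrite -(leq_padic_val _ fi0).
Qed.

End Newton.

(** * Compactness of Z_p *)

Section Konig.
Variables (p : nat) (S : nat -> set (padic_int p)).

(** Compactness of Z_p, in the form of Koenig's lemma on the p-ary tree of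
    residues: a point of the intersection is built digit by digit, keeping only
    residue classes that meet every S m. *)
Lemma padic_konig : prime p ->
  (forall m, S m.+1 `<=` S m) ->
  (forall m (x y : padic_int p), x m = y m -> S m x -> S m y) ->
  (forall m, S m !=set0) -> exists x, forall m, S m x.
Proof.
move=> hp decS levelS neS.
have leS m k : (m <= k)%N -> S k `<=` S m.
  elim: k => [|k IH]; first by rewrite leqn0 => /eqP->.
  rewrite leq_eqVlt => /orP[/eqP->//|]; rewrite ltnS => /IH kS x /decS.
  exact: kS.
pose good n (y : padic_int p) := forall m, exists2 x, S m x & x n = y n.
have step n (y : padic_int p) : exists y' : padic_int p,
    good n y -> y' n = y n /\ good n.+1 y'.
  have [[y' [yn gy']]|nex] :=
      pselect (exists y' : padic_int p, y' n = y n /\ good n.+1 y').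
    by exists y'.
  exists y => gy; exfalso; apply: nex.
  (* If no residue class refining that of y were good, each would miss some
     S m; as there are finitely many, a single S M would miss them all. *)
  suff [b hb] : exists b : 'I_(p ^ n.+1), forall m,
      exists x, [/\ S m x, x n = y n & x n.+1 = b%:Z].
    have [y' [_ yn yb]] := hb 0%N; exists y'; split=> // m.
    by have [x [Sx _ xb]] := hb m; exists x => //; rewrite xb yb.
  apply: contrapT => none.
  have /choice[mb hmb] : forall b : 'I_(p ^ n.+1), exists m,
      forall x, S m x -> x n = y n -> x n.+1 <> b%:Z.
    move=> b; apply: contrapT => nb; apply: none; exists b => m.
    apply: contrapT => nx; apply: nb; exists m => x Sx xn xb.
    by apply: nx; exists x.
  pose M := \max_b mb b.
  have [x Sx xn] := gy M.
  have pn0 : (0 < p ^ n.+1)%N by rewrite expn_gt0 prime_gt0.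
  have xge0 : 0 <= x n.+1 by rewrite -padic_mod modz_ge0// -lt0n.
  have xlt : (`|x n.+1| < p ^ n.+1)%N.
    by rewrite -ltz_nat gez0_abs// -{1}padic_mod ltz_pmod.
  apply: (hmb (Ordinal xlt) x) => //; last by rewrite /= gez0_abs.
  by apply: leS Sx; exact: leq_bigmax.
pose next n y := projT1 (cid (step n y)).
have nextP n y : good n y -> next n y n = y n /\ good n.+1 (next n y).
  exact: projT2 (cid (step n y)).
pose Y := nat_rect (fun=> padic_int p) 0 next.
have gY n : good n (Y n).
  elim: n => [m|n /nextP[]//].
  by have [x Sx] := neS m; exists x => //; rewrite !padic_res_level0.
have compat n : (Y n.+1 n.+1 = Y n n %[mod (p ^ n)%N])%Z.
  by have [<- _] := nextP _ _ (gY n); exact: padic_compat.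
exists (padic_of compat) => n; have [x Sx xn] := gY n n.
by apply: levelS Sx; rewrite xn /= padic_mod.
Qed.

End Konig.

Section Strata.
Variable p : nat.
Hypothesis hp : prime p.
Implicit Types (x y h : padic_int p) (f g : nat -> padic_int p).

Lemma uniform_nondegeneracy f : coef_to0 f ->
  (forall x, ~ (ps_eval f x = 0 /\ ps_eval (ps_deriv f) x = 0)) ->
  exists m, forall x, ~ (ps_eval f x m = 0 /\ ps_eval (ps_deriv f) x m = 0).
Proof.
move=> f0 nz; have f0' := coef_to0_deriv f0.
apply: contrapT => none.
pose S m := [set x | ps_eval f x m = 0 /\ ps_eval (ps_deriv f) x m = 0].
have [] := @padic_konig p S hp.
- by move=> m x [e e']; split; rewrite padic_resP ?e ?e' mod0z.
- move=> m x y exy [e e']; split.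
    by rewrite (ps_eval_congr f0 f0 _ (esym exy)).
  by rewrite (ps_eval_congr f0' f0' _ (esym exy)).
- move=> m; apply: contrapT => ne; apply: none; exists m => x Sx.
  by apply: ne; exists x.
move=> x Sx; apply: (nz x); split; apply: padic_ext => n; rewrite padic_res0;
  by have [] := Sx n.
Qed.

(** * Solutions modulo powers of p and the order of the derivative *)

Definition zeros_mod g n := [set x | ps_eval g x n = 0].

(** Solutions modulo p^n at which the derivative has valuation exactly [e]. *)
Definition zero_stratum g e n := [set x | [/\ ps_eval g x n = 0,
  ps_eval (ps_deriv g) x e = 0 & ps_eval (ps_deriv g) x e.+1 <> 0]].

(** With g(x) = a p^n and g'(x) = u p^e, the first order condition for a lift
    modulo p^(n+1) becomes a linear congruence for the digit [t] modulo p. *)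
Lemma newton_digitE e n (a u : int) t : (e <= n)%N ->
  ((p ^ n.+1)%N %| a * (p ^ n)%N%:Z
      + (p ^ (n - e) * t)%N%:Z * (u * (p ^ e)%N%:Z))%Z
  = (p %| a + t%:Z * u)%Z.
Proof.
move=> en.
have -> : a * (p ^ n)%N%:Z + (p ^ (n - e) * t)%N%:Z * (u * (p ^ e)%N%:Z)
    = (a + t%:Z * u) * (p ^ n)%N%:Z.
  by rewrite -[in RHS](subnK en) -[in LHS](subnK en) addnK expnD !PoszM; ring.
by rewrite expnS PoszM dvdz_mul2r// eqz_nat -lt0n expn_gt0 prime_gt0.
Qed.

Lemma exists_unique_digit (a u : int) : ~~ (p %| u)%Z ->
  exists t, [/\ (t < p)%N, (p %| a + t%:Z * u)%Z &
    forall t', (t' < p)%N -> (p %| a + t'%:Z * u)%Z -> t' = t].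
Proof.
move=> pu.
have cop : coprimez p u by rewrite /coprimez /gcdz /= -prime_coprime// in pu *.
have /coprimezP[[v w] /= vw] := cop.
have p0 : p%:Z != 0 by rewrite eqz_nat -lt0n prime_gt0.
have tge0 : 0 <= (- (a * w) %% p)%Z by rewrite modz_ge0.
have tabs : `|(- (a * w) %% p)%Z|%N%:Z = (- (a * w) %% p)%Z by rewrite gez0_abs.
have tlt : (`|(- (a * w) %% p)%Z| < p)%N.
  by rewrite -ltz_nat tabs ltz_pmod// ltz_nat prime_gt0.
have div_t : (p %| a + `|(- (a * w) %% p)%Z|%N%:Z * u)%Z.
  rewrite tabs; apply/dvdz_mod0P; rewrite -modzDmr modzMml modzDmr.
  apply/dvdz_mod0P/dvdzP; exists (a * v).
  by rewrite -[X in X + _]mulr1 -vw; ring.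
move: tlt div_t; move: `|_|%N => t tlt div_t.
exists t; split=> // t' t'p div_t'.
have := rpredB div_t' div_t.
rewrite opprD addrACA subrr add0r -mulrBl Gauss_dvdzl// -eqz_mod_dvd.
by rewrite !modz_nat !modn_small// => /eqP[].
Qed.

Lemma zero_stratum_res g e n x : coef_to0 g -> (e <= n)%N ->
  zero_stratum g e n x -> exists a u : int,
    [/\ ~~ (p %| u)%Z, ps_eval g x n.+1 = a * (p ^ n)%N%:Z
      & ps_eval (ps_deriv g) x n.+1 = u * (p ^ e)%N%:Z].
Proof.
move=> g0 en [gx /eqP g'x g'xS]; move/eqP: gx.
rewrite -(padic_res_dvdz _ (leqnSn n)) => /dvdzP[a ea].
move: g'x; rewrite -(padic_res_dvdz _ (leqW en)) => /dvdzP[u eu].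
exists a, u; split=> //; apply: contra_notN g'xS => pu; apply/eqP.
rewrite -(padic_res_dvdz _ (_ : e.+1 <= n.+1)%N)// eu expnS PoszM.
exact: dvdz_mul.
Qed.

(** A shift by a multiple of p^(n-e) changes g(x) by a multiple of
    p^(n-e) p^e modulo p^n, and it preserves the valuation e of g'(x) because
    e < n - e. *)
Lemma zero_stratum_shift g e n x h : coef_to0 g -> (e.*2 < n)%N ->
  h (n - e)%N = 0 -> zero_stratum g e n x -> zero_stratum g e n (x + h).
Proof.
move=> g0 en h0 sx; have g0' := coef_to0_deriv g0.
have le_en : (e <= n)%N by lia.
have e_lt : (e < n - e)%N by lia.
have [gx g'x g'xS] := sx.
have eqx k : (k <= n - e)%N -> (x + h) k = x k.
  by move=> kn; rewrite padic_addr_res0// (padic_res_modz _ kn) h0 mod0z.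
split.
- rewrite (ps_eval_newton x g0 h0); last first.
    by lia.
  rewrite gx add0r; apply/dvdz_mod0P.
  have -> : (p ^ n = p ^ (n - e) * p ^ e)%N by rewrite -expnD subnK.
  rewrite PoszM.
  by apply: dvdz_mul; rewrite padic_res_dvdz ?leq_subr ?h0 ?g'x.
- by rewrite (ps_eval_congr g0' g0' _ (eqx e (ltnW e_lt))).
- by rewrite (ps_eval_congr g0' g0' _ (eqx e.+1 e_lt)).
Qed.

Lemma zero_stratumS g e n : zero_stratum g e n.+1 `<=` zero_stratum g e n.
Proof. by move=> x [gx ? ?]; split=> //; rewrite padic_resP gx mod0z. Qed.

(** Hensel's lemma as a statement on sets: moving a solution modulo p ^ n by
    the p multiples of p ^ (n - e) changes the value by all the multiples of
    p ^ n modulo p ^ n.+1, each once, since the derivative is a unit times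
    p ^ e. The second order term is a multiple of p ^ (2 (n - e)), and
    2 (n - e) > n by the bound on [e]. *)
Lemma zero_stratum_lift g e n x : coef_to0 g -> (e.*2 < n)%N ->
  zero_stratum g e n x -> exists t, [/\ (t < p)%N,
    zero_stratum g e n.+1 (x + (p ^ (n - e) * t)%:R) &
    forall t', (t' < p)%N ->
      zero_stratum g e n.+1 (x + (p ^ (n - e) * t')%:R) -> t' = t].
Proof.
move=> g0 en sx.
have le_en : (e <= n)%N by lia.
have [a [u [pu ea eu]]] := zero_stratum_res g0 le_en sx.
pose h t : padic_int p := (p ^ (n - e) * t)%:R.
have h0 t : h t (n - e)%N = 0 by exact: padic_digit_res0.
have liftE t : zero_stratum g e n.+1 (x + h t) <-> (p %| a + t%:Z * u)%Z.
  have -> : (p %| a + t%:Z * u)%Z = (ps_eval g (x + h t) n.+1 == 0).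
    rewrite (ps_eval_newton x g0 (h0 t)); last first.
      by lia.
    rewrite ea eu padic_res_nat -(newton_digitE _ _ _ le_en).
    by apply/dvdz_mod0P/eqP; rewrite -modzDmr modzMml modzDmr.
  split=> [[/eqP]//|/eqP gx]; split=> //;
    by have [] := zero_stratum_shift g0 en (h0 t) sx.
have [t [tp dt ut]] := exists_unique_digit a pu.
by exists t; split=> // [|t' t'p /liftE]; [exact/liftE|exact: ut].
Qed.

End Strata.

(** * Haar measure of the strata *)

Section HaarStrata.
Variables (R : realType) (p : nat).
Variable mu : {measure set (padic_borel p) -> \bar R}.
Hypothesis hp : prime p.
Hypothesis hmu : normalized_haar mu.
Implicit Types (f g : nat -> padic_int p) (A : set (padic_int p)).

Lemma measurable_level A n :
  (forall x y : padic_int p, x n = y n -> A x -> A y) ->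
  measurable (A : set (padic_borel p)).
Proof.
move=> lA; apply: sub_sigma_algebra.
suff: padic_open A by [].
by move=> x Ax; exists n => y yx; apply: lA Ax.
Qed.

Lemma measurable_zeros_mod g n : coef_to0 g ->
  measurable (zeros_mod g n : set (padic_borel p)).
Proof.
move=> g0; apply: (@measurable_level _ n) => x y exy.
by rewrite /zeros_mod /= (ps_eval_congr g0 g0 _ exy).
Qed.

Lemma zero_stratum_level g e n (x y : padic_int p) : coef_to0 g ->
  x (maxn n e.+1) = y (maxn n e.+1) -> zero_stratum g e n x ->
  zero_stratum g e n y.
Proof.
move=> g0 exy [gx g'x g'xS]; have g0' := coef_to0_deriv g0.
have ek k : (k <= maxn n e.+1)%N -> y k = x k.
  by move=> kn; rewrite (padic_res_modz y kn) -exy -padic_res_modz.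
split.
- by rewrite (ps_eval_congr g0 g0 _ (ek _ _)) ?leq_maxl.
- by rewrite (ps_eval_congr g0' g0' _ (ek _ _)) ?leq_max// leqnSn orbT.
- by rewrite (ps_eval_congr g0' g0' _ (ek _ _)) ?leq_maxr.
Qed.

Lemma measurable_zero_stratum g e n : coef_to0 g ->
  measurable (zero_stratum g e n : set (padic_borel p)).
Proof.
by move=> g0; apply: measurable_level => x y; exact: zero_stratum_level.
Qed.

Lemma haar_lt_pinfty A :
  measurable (A : set (padic_borel p)) -> (mu A < +oo)%E.
Proof.
move=> mA; have [mu1 _] := hmu.
apply: (@le_lt_trans _ _ (mu setT)); last by rewrite mu1 ltry.
by apply: le_measure; rewrite ?inE//; exact: measurableT.
Qed.

Lemma haar_shift A (c : padic_int p) :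
  measurable (A : set (padic_borel p)) -> mu [set x | A (x + c)] = mu A.
Proof.
move=> mA; have [_ tr] := hmu; rewrite -(tr (- c) A mA); congr (mu _).
apply/seteqP; split=> [x Ax|_ [x Ax <-]] /=.
  by exists (x + c) => //; rewrite addrC addrK.
by rewrite addrAC addNr add0r.
Qed.

Lemma measurable_shift A n (c : padic_int p) :
  (forall x y : padic_int p, x n = y n -> A x -> A y) ->
  measurable ([set x | A (x + c)] : set (padic_borel p)).
Proof.
move=> lA; apply: (@measurable_level _ n) => x y exy /=.
by apply: lA; exact: padic_congrD.
Qed.

Lemma measure_partition A n (F : nat -> set (padic_borel p)) :
  (forall k, measurable (F k)) -> trivIset `I_n F ->
  A = \bigcup_(k in `I_n) F k -> mu A = (\sum_(k < n) mu (F k))%E.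
Proof.
move=> mF tF ->; rewrite bigcup_mkord measure_semi_additive_ord_I//.
by apply: bigsetU_measurable => i _; exact: mF.
Qed.

(** Each lifting digit accounts for one translate of the refined stratum, and
    translates have equal measure. *)
Lemma haar_zero_stratumS g e n : coef_to0 g -> (e.*2 < n)%N ->
  mu (zero_stratum g e n.+1) = (p%:R^-1%:E * mu (zero_stratum g e n))%E.
Proof.
move=> g0 en; have mS := measurable_zero_stratum e n.+1 g0.
pose c t : padic_int p := (p ^ (n - e) * t)%:R.
pose F t : set (padic_borel p) := [set x | zero_stratum g e n.+1 (x + c t)].
have c0 t : c t (n - e)%N = 0 by exact: padic_digit_res0.
have subF t : F t `<=` zero_stratum g e n.
  move=> x /zero_stratumS sx; rewrite -(addrK (c t) x).
  apply: zero_stratum_shift sx => //.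
  by rewrite padic_resN c0 oppr0 mod0z.
have mF t : measurable (F t).
  by apply: measurable_shift => x y; exact: zero_stratum_level.
have tF : trivIset `I_p F.
  move=> i j ip jp [x [Fi Fj]].
  have [t [_ _ ut]] := zero_stratum_lift hp g0 en (subF _ _ Fi).
  by rewrite (ut i ip Fi) (ut j jp Fj).
have -> : mu (zero_stratum g e n) = (\sum_(t < p) mu (F t))%E.
  apply: measure_partition => //.
  apply/seteqP; split=> [x sx|x [t _ Ft]]; last exact: subF Ft.
  by have [t [tp st _]] := zero_stratum_lift hp g0 en sx; exists t.
under eq_bigr do rewrite haar_shift//.
have p0 : p%:R != 0 :> R by rewrite pnatr_eq0 -lt0n prime_gt0.
rewrite -(@fineK _ (mu (zero_stratum g e n.+1))); last first.
  by rewrite ge0_fin_numE ?haar_lt_pinfty.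
by rewrite sumEFin sumr_const card_ord -EFinM -(mulr_natl (fine _)) mulKf.
Qed.

(** Non-degeneracy modulo p^m says that the derivative has valuation below m at
    every solution modulo p^n, so finitely many strata cover; n >= 2m is what
    the recursion on each of them requires. *)
Lemma haar_zeros_modS g m n : coef_to0 g ->
  (forall x, ~ (ps_eval g x m = 0 /\ ps_eval (ps_deriv g) x m = 0)) ->
  (m.*2 <= n)%N ->
  mu (zeros_mod g n.+1) = (p%:R^-1%:E * mu (zeros_mod g n))%E.
Proof.
move=> g0 nd mn.
have split_zeros k : (m <= k)%N ->
    mu (zeros_mod g k) = (\sum_(e < m) mu (zero_stratum g e k))%E.
  move=> mk; apply: (measure_partition (F := fun e => zero_stratum g e k)).
  - by move=> e; exact: measurable_zero_stratum.
  - have no_lt i j x : zero_stratum g i k x -> zero_stratum g j k x ->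
        ~ (i < j)%N.
      move=> [_ _ iS] [_ j0 _] ij; apply: iS.
      by rewrite (padic_res_modz _ ij) j0 mod0z.
    move=> i j _ _ [x [si sj]].
    by case: (ltngtP i j) => // [/(no_lt _ _ _ si sj)|/(no_lt _ _ _ sj si)].
  apply/seteqP; split=> [x gx|x [e _ [gx _ _]]]; last exact: gx.
  have gxm : ps_eval g x m = 0 by rewrite (padic_res_modz _ mk) gx mod0z.
  have g'x : ps_eval (ps_deriv g) x m != 0.
    by apply/eqP => g'x; apply: (nd x).
  have ex : exists i, ps_eval (ps_deriv g) x i != 0 by exists m.
  case: (ex_minnP ex) => -[|e] ne0 least.
    by move: ne0; rewrite padic_res_level0.
  exists e; first exact: least.
  split=> //; last exact/eqP.
  by apply: contrapT => /eqP/least; rewrite ltnn.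
rewrite !split_zeros; [|by lia..].
rewrite ge0_sume_distrr//; apply: eq_bigr => e _.
by apply: haar_zero_stratumS => //; have := ltn_ord e; lia.
Qed.

End HaarStrata.

(** * Integrals of discrete functions *)

Section DiscreteIntegral.
Context d (T : measurableType d) (R : realType).
Variable mu : {measure set T -> \bar R}.

Lemma preimage_nat_bigcup (V : T -> nat) (A : set nat) :
  V @^-1` A = \bigcup_(k in A) V @^-1` [set k].
Proof.
apply/seteqP; split=> [x Ax|x [k Ak /= ->//]].
by exists (V x).
Qed.

Lemma measurable_preimage_nat (V : T -> nat) (A : set nat) :
  (forall k, measurable (V @^-1` [set k])) -> measurable (V @^-1` A).
Proof.
move=> mV; rewrite preimage_nat_bigcup.
by apply: bigcup_measurable => k _; exact: mV.
Qed.

Lemma measure_preimage_nat (V : T -> nat) (A : set nat) :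
  (forall k, measurable (V @^-1` [set k])) ->
  mu (V @^-1` A) = (\sum_(0 <= k <oo | k \in A) mu (V @^-1` [set k]))%E.
Proof.
move=> mV; rewrite preimage_nat_bigcup.
apply: measure_bigcup => [k _|]; first exact: mV.
by move=> i j _ _ [x [/= <- <-]].
Qed.

(** Both integrals are integrals of [c] over nat, for the image measures of
    [V] and [W]. Splitting into positive and negative parts dispenses with
    integrability of [c \o V]. *)
Lemma Rintegral_comp_nat (V W : T -> nat) (c : nat -> R) :
  (forall k, measurable (V @^-1` [set k])) ->
  (forall k, measurable (W @^-1` [set k])) ->
  (forall k, mu (V @^-1` [set k]) = mu (W @^-1` [set k])) ->
  \int[mu]_x c (V x) = \int[mu]_x c (W x).
Proof.
move=> mV mW eVW.
have fV : measurable_fun setT V.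
  by move=> _ A _; rewrite setTI; exact: measurable_preimage_nat.
have fW : measurable_fun setT W.
  by move=> _ A _; rewrite setTI; exact: measurable_preimage_nat.
have ge0_eq (a : nat -> \bar R) : (forall k, 0 <= a k)%E ->
    (\int[mu]_x a (V x) = \int[mu]_x a (W x))%E.
  move=> a0.
  rewrite -[LHS](ge0_integral_pushforward fV mu (D := setT) (f := a))//.
  rewrite -[RHS](ge0_integral_pushforward fW mu (D := setT) (f := a))//.
  apply: eq_measure_integral => A _ _.
  suff: mu (V @^-1` A) = mu (W @^-1` A) by [].
  by rewrite !measure_preimage_nat//; apply: eq_eseriesr => k _.
have intE (U : T -> nat) : (\int[mu]_x (c (U x))%:E =
    \int[mu]_x ((EFin \o c)^\+ (U x)) - \int[mu]_x ((EFin \o c)^\- (U x)))%E.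
  have := integralE mu setT ((EFin \o c) \o U).
  by rewrite funepos_comp funeneg_comp.
rewrite /Rintegral !intE.
by rewrite !(ge0_eq _ (funepos_ge0 _)) !(ge0_eq _ (funeneg_ge0 _)).
Qed.

End DiscreteIntegral.

(** * The zeta function and the measures of the solution sets *)

Section Zeta.
Variables (R : realType) (p : nat).
Variable mu : {measure set (padic_borel p) -> \bar R}.
Hypothesis hp : prime p.
Hypothesis hmu : normalized_haar mu.
Implicit Types (f g : nat -> padic_int p) (s : R[i]).

(** The valuation of g(x) shifted by one, the code 0 standing for an infinite
    valuation: an encoding of |g(x)| in nat. *)
Definition val_code g (x : padic_borel p) : nat :=
  if ps_eval g x == 0 then 0%N else (padic_val (ps_eval g x)).+1.

Lemma val_code_preimage0 g :
  val_code g @^-1` [set 0%N] = \bigcap_n zeros_mod g n.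
Proof.
apply/seteqP; split=> x; rewrite /val_code /=.
  by case: eqP => // g0 _ n _; rewrite /zeros_mod /= g0 padic_res0.
case: eqVneq => // gx0 gx; have [_] := padic_valP gx0.
by move/(_ (gx _ I)).
Qed.

Lemma val_code_preimageS g k :
  val_code g @^-1` [set k.+1] = zeros_mod g k `\` zeros_mod g k.+1.
Proof.
apply/seteqP; split=> x; rewrite /val_code /zeros_mod /=.
  by case: eqVneq => // gx0 [<-]; exact: padic_valP.
move=> [gk /eqP gkS]; case: eqVneq => [g0|gx0].
  by move: gkS; rewrite g0 padic_res0 eqxx.
congr _.+1; apply/eqP; rewrite eqn_leq (leq_padic_val _ gx0) gk eqxx andbT.
by rewrite -ltnS ltnNge (leq_padic_val _ gx0).
Qed.

Lemma measurable_val_code g k : coef_to0 g ->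
  measurable (val_code g @^-1` [set k]).
Proof.
move=> g0; case: k => [|k]; rewrite ?val_code_preimage0 ?val_code_preimageS.
  by apply: bigcap_measurable => // n _; exact: measurable_zeros_mod.
by apply: measurableD; exact: measurable_zeros_mod.
Qed.

Lemma zeros_modS g n : zeros_mod g n.+1 `<=` zeros_mod g n.
Proof. by rewrite /zeros_mod => x /= gx; rewrite padic_resP gx mod0z. Qed.

(** Finite valuations occur on differences of consecutive solution sets, the
    infinite one on their decreasing intersection. *)
Lemma measure_val_code_eq f g : coef_to0 f -> coef_to0 g ->
  (forall n, mu (zeros_mod f n) = mu (zeros_mod g n)) ->
  forall k, mu (val_code f @^-1` [set k]) = mu (val_code g @^-1` [set k]).
Proof.
move=> f0 g0 efg [|k]; last first.
  rewrite !val_code_preimageS.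
  rewrite !measureD ?haar_lt_pinfty//; try exact: measurable_zeros_mod.
  by rewrite !(setIidr (@zeros_modS _ k)); congr (_ - _)%E; exact: efg.
rewrite !val_code_preimage0.
have cvg_bigcap h (u : nat -> \bar R) : coef_to0 h ->
    (forall n, mu (zeros_mod h n) = u n) ->
    u @ \oo --> mu (\bigcap_n zeros_mod h n).
  move=> h0 /funext <-; apply: nonincreasing_cvg_mu.
  - by rewrite haar_lt_pinfty//; exact: measurable_zeros_mod.
  - by move=> i; exact: measurable_zeros_mod.
  - by apply: bigcap_measurable => // n _; exact: measurable_zeros_mod.
  - apply/nonincreasing_seqP => n; apply/subsetPset; exact: zeros_modS.
by apply: (cvg_unique _ (cvg_bigcap f _ f0 efg)) => //; exact: cvg_bigcap.
Qed.

Lemma igusa_zeta_eq f g s : coef_to0 f -> coef_to0 g ->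
  (forall n, mu (zeros_mod f n) = mu (zeros_mod g n)) ->
  igusa_zeta mu f s = igusa_zeta mu g s.
Proof.
move=> f0 g0 efg.
pose c k := cpow (if k is k'.+1 then p%:R ^- k' else 0 : R) s.
have zetaE h (r : R[i] -> R) :
    (fun x => r (cpow (padic_abs R (ps_eval h x)) s))
    = (fun x => r (c (val_code h x))).
  by apply/funext => x; rewrite /padic_abs /val_code /c; case: ifP.
have int_eq (r : R[i] -> R) :
    \int[mu]_x r (cpow (padic_abs R (ps_eval f x)) s)
    = \int[mu]_x r (cpow (padic_abs R (ps_eval g x)) s).
  rewrite !zetaE; apply: (Rintegral_comp_nat (fun k => r (c k))).
  - by move=> k; exact: measurable_val_code.
  - by move=> k; exact: measurable_val_code.
  - exact: measure_val_code_eq.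
by rewrite /igusa_zeta /Cintegral !int_eq.
Qed.

(** The precision 2m is the rank from which [haar_zeros_modS] applies, and it
    is at least m, so that non-degeneracy passes from f to g. *)
Lemma igusa_zeta_congr f g m s : coef_to0 f -> coef_to0 g ->
  (forall x, ~ (ps_eval f x m = 0 /\ ps_eval (ps_deriv f) x m = 0)) ->
  (forall i, f i m.*2 = g i m.*2) ->
  igusa_zeta mu f s = igusa_zeta mu g s.
Proof.
move=> f0 g0 nd efg.
have eval_eq n x : (n <= m.*2)%N -> ps_eval f x n = ps_eval g x n.
  move=> nm; apply: ps_eval_congr => // i.
  by rewrite !(padic_res_modz _ nm) efg.
have deriv_eq x : ps_eval (ps_deriv f) x m = ps_eval (ps_deriv g) x m.
  apply: ps_eval_congr => // [| |i]; try exact: coef_to0_deriv.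
  apply: padic_congr_mulrn.
  by rewrite !(padic_res_modz _ (_ : m <= m.*2)%N) ?efg// -addnn leq_addr.
have ndg x : ~ (ps_eval g x m = 0 /\ ps_eval (ps_deriv g) x m = 0).
  by rewrite -deriv_eq -eval_eq ?(nd x)// -addnn leq_addr.
apply: igusa_zeta_eq => // n.
have low k : (k <= m.*2)%N -> mu (zeros_mod f k) = mu (zeros_mod g k).
  move=> km; congr (mu _); apply/seteqP.
  by split=> x; rewrite /zeros_mod /= eval_eq.
elim: n => [|n IH]; first exact: low.
have [lt|le] := ltnP n m.*2; first exact: low.
rewrite (haar_zeros_modS hp hmu f0 nd le).
by rewrite (haar_zeros_modS hp hmu g0 ndg le) IH.
Qed.

End Zeta.

Theorem proposition3p3 (R : realType) (p : nat) (hp : prime p)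
    (mu : {measure set (padic_borel p) -> \bar R})
    (hmu : normalized_haar mu)
    (f : nat -> padic_int p) (hf : restricted R f)
    (hff' : forall x : padic_int p,
        ~ (ps_eval f x = 0 /\ ps_eval (ps_deriv f) x = 0)) :
  exists N : nat, forall D : nat, (N <= D)%N ->
    forall s : R[i], 0 < complex.Re s ->
      igusa_zeta mu (ps_trunc D f) s = igusa_zeta mu f s.
Proof.
have f0 := restricted_coef_to0 hp hf.
have [m nd] := uniform_nondegeneracy hp f0 hff'.
have [N fN] := f0 m.*2.
exists N => D ND s _; apply/esym.
apply: (igusa_zeta_congr hp hmu s f0 (@coef_to0_trunc _ f D) nd) => i.
rewrite /ps_trunc; case: leqP => // Di.
by rewrite fN ?padic_res0// (leq_trans ND (ltnW Di)).
Qed.
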